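(* Let $k\ge 1$ and let $\mathcal{R}=\{\rho_1,\ldots,\rho_h\}$ be a traversal for the iterated wreath product $W(\vec r|_{k-1})$. Let $J\subseteq [h]^{r_k}$ be a set of representatives of the $\mathbb{Z}_{r_k}$-orbits on $[h]^{r_k}$, so that $[h]^{r_k}=\bigsqcup_{x\in J}x^{\mathbb{Z}_{r_k}}$. Then a traversal for $W(\vec r|_k)$ is given by $$\mathcal{R}_{W(\vec r|_k)}=\left\{\mathrm{Ind}_{W(\vec r|_{k-1})^{r_k}\rtimes \mathbb{Z}_{d_x}}^{W(\vec r|_k)}\left(\rho_{x_1}\otimes\cdots\otimes\rho_{x_{r_k}}\otimes\tau\right)\;:\;x=x_1\cdots x_{r_k}\in J,\ \tau\in\widehat{\mathbb{Z}_{d_x}}\right\}.$$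
   Context: All representations are finite-dimensional over $\mathbb{C}$. For a finite group $G$, $\widehat G$ denotes the set of equivalence classes of irreducible representations of $G$; a traversal for $G$ is a set of irreducible representations containing exactly one representative of each class in $\widehat G$. For a finite group $G$ and a subgroup $H\le S_n$, the wreath product $G\wr H$ is $G^n\times H$ as a set with multiplication $(a;\pi)(b;\sigma)=(ab^{\pi};\pi\sigma)$, where $b^{\pi}=(b_{\pi^{-1}(1)},\ldots,b_{\pi^{-1}(n)})$; thus $G\wr H=G^n\rtimes H$. The cyclic group $\mathbb{Z}_r$ is regarded as the subgroup of $S_r$ generated by an $r$-cycle rotating $1,\ldots,r$ cyclically. Fix a sequence of positive integers $\vec r=(r_1,r_2,\ldots)$ and write $\vec r|_k=(r_1,\ldots,r_k)$. Define recursively $W(\vec r|_0)$ to be the trivial group and $W(\vec r|_k)=W(\vec r|_{k-1})\wr\mathbb{Z}_{r_k}=W(\vec r|_{k-1})^{r_k}\rtimes\mathbb{Z}_{r_k}$. $[h]=\{1,\ldots,h\}$ and $[h]^{\ell}$ is the set of words of length $\ell$ with letters in $[h]$. The group $\mathbb{Z}_{r_k}$ acts on $[h]^{r_k}$ by cyclic rotation: $i\cdot x=x^i:=x_{i+1}\cdots x_{r_k}x_1\cdots x_i$, and $x^{\mathbb{Z}_{r_k}}$ denotes the orbit of $x$. For $x\in[h]^{r_k}$, $d_x$ denotes the order of the stabilizer of $x$ in $\mathbb{Z}_{r_k}$, and $\mathbb{Z}_{d_x}\cong (\tfrac{r_k}{d_x}\mathbb{Z})/(r_k\mathbb{Z})$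 denotes this stabilizer, viewed as a subgroup of $\mathbb{Z}_{r_k}$. The representation $\rho_{x_1}\otimes\cdots\otimes\rho_{x_{r_k}}\otimes\tau$ of $W(\vec r|_{k-1})^{r_k}\rtimes\mathbb{Z}_{d_x}$ is as follows: $W(\vec r|_{k-1})^{r_k}$ acts on $\rho_{x_1}\otimes\cdots\otimes\rho_{x_{r_k}}$ factor by factor, $\mathbb{Z}_{d_x}$ acts on it by permuting the tensor factors (this is possible since $\mathbb{Z}_{d_x}$ fixes the word $x$), and the resulting representation is tensored with $\tau$, regarded as a representation of $W(\vec r|_{k-1})^{r_k}\rtimes\mathbb{Z}_{d_x}$ via the projection onto $\mathbb{Z}_{d_x}$. *)

(* Defs.v *)
From HB Require Import structures.
From mathcomp Require Import all_boot all_order all_algebra all_fingroup.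
From mathcomp Require Import all_character.

Set Implicit Arguments.
Unset Strict Implicit.
Unset Printing Implicit Defensive.

Import GroupScope GRing.Theory.
Local Open Scope ring_scope.

(* b ^ s = (b_(s^-1 0), ..., b_(s^-1 (n - 1))).  The product of 'S_n composes
   from left to right, so that s |-> (b |-> b ^ s) is a right action for it;
   with permutations composed as functions it is a left action. *)
Definition perm_word n (T : Type) (b : {ffun 'I_n -> T}) (s : 'S_n) :
    {ffun 'I_n -> T} :=
  [ffun i => b (s^-1%g i)].

Lemma perm_word1 n (T : Type) (b : {ffun 'I_n -> T}) : perm_word b 1%g = b.
Proof. by apply/ffunP=> i; rewrite ffunE invg1 perm1. Qed.

Lemma perm_wordM n (T : Type) (b : {ffun 'I_n -> T}) (s t : 'S_n) :
  perm_word b (s * t)%g = perm_word (perm_word b s) t.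
Proof. by apply/ffunP=> i; rewrite !ffunE invMg permM. Qed.

Definition perm_word_action n (T : Type) :=
  TotalAction (@perm_word1 n T) (@perm_wordM n T).

(* The full wreath product of gT by 'S_n, as a type. *)
Record wreath_type (gT : finGroupType) (n : nat) :=
  Wreath { wbase : {ffun 'I_n -> gT}; wtop : 'S_n }.

Section WreathType.
Variables (gT : finGroupType) (n : nat).
Local Notation wrT := (wreath_type gT n).

Definition wreath_pair (u : wrT) := (wbase u, wtop u).
Definition pair_wreath (p : {ffun 'I_n -> gT} * 'S_n) : wrT :=
  Wreath p.1 p.2.

Lemma wreath_pairK : cancel wreath_pair pair_wreath.
Proof. by case. Qed.

HB.instance Definition _ := Finite.copy wrT (can_type wreath_pairK).

Definition wreath_one : wrT := Wreath [ffun=> 1%g] 1%g.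

(* (a ; p) (b ; s) = (a b ^ p ; p o s): composition of functions is the
   opposite of the product of 'S_n. *)
Definition wreath_mul (u v : wrT) : wrT :=
  Wreath [ffun i => (wbase u i * perm_word (wbase v) (wtop u) i)%g]
         (wtop v * wtop u)%g.

Definition wreath_inv (u : wrT) : wrT :=
  Wreath (perm_word [ffun i => (wbase u i)^-1%g] (wtop u)^-1%g) (wtop u)^-1%g.

Lemma wreath_mulA : associative wreath_mul.
Proof.
move=> [a s] [b t] [c q]; rewrite /wreath_mul /= mulgA; congr Wreath.
by apply/ffunP=> i; rewrite !ffunE invMg permM mulgA.
Qed.

Lemma wreath_mul1 : left_id wreath_one wreath_mul.
Proof.
move=> [a s]; rewrite /wreath_mul /= mulg1; congr Wreath.
by apply/ffunP=> i; rewrite !ffunE invg1 perm1 mul1g.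
Qed.

Lemma wreath_mulV : left_inverse wreath_one wreath_inv wreath_mul.
Proof.
move=> [a s]; rewrite /wreath_mul /= mulgV; congr Wreath.
by apply/ffunP=> i; rewrite !ffunE mulVg.
Qed.

HB.instance Definition _ :=
  Finite_isGroup.Build wrT wreath_mulA wreath_mul1 wreath_mulV.

End WreathType.

Definition wreath_set (gT : finGroupType) n (G : {set gT}) (H : {set 'S_n}) :
    {set wreath_type gT n} :=
  [set u | [forall i, wbase u i \in G] && (wtop u \in H)].

Lemma wreath_group_set (gT : finGroupType) n (G : {group gT})
  (H : {group 'S_n}) : group_set (wreath_set G H).
Proof.
apply/group_setP; split=> [|u v].
  by rewrite inE group1 andbT; apply/forallP=> i; rewrite ffunE.
rewrite !inE => /andP[/forallP Gu Hu] /andP[/forallP Gv Hv].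
by rewrite groupM // andbT; apply/forallP=> i; rewrite !ffunE groupM.
Qed.

Definition wreath (gT : finGroupType) n (G : {group gT}) (H : {group 'S_n}) :
    {group wreath_type gT n} :=
  Group (wreath_group_set G H).

Lemma mem_wreath (gT : finGroupType) n (G : {group gT}) (H : {group 'S_n}) u :
  (u \in wreath G H) = [forall i, wbase u i \in G] && (wtop u \in H).
Proof. by rewrite inE. Qed.

Lemma wreathS (gT : finGroupType) n (G : {group gT}) (H K : {group 'S_n}) :
  H \subset K -> wreath G H \subset wreath G K.
Proof.
move=> sHK; apply/subsetP=> u; rewrite !inE => /andP[-> Hu].
exact: subsetP sHK _ Hu.
Qed.

Definition rotp n : 'S_n := perm (@ord_pred_inj n).

Definition Zrot n : {group 'S_n} := <[rotp n]>%G.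

(* With this choice of the generating n-cycle, its i-th power takes the word
   x_0 ... x_(n - 1) to x_i ... x_(n - 1) x_0 ... x_(i - 1). *)
Lemma perm_word_rotp n (T : Type) (x : {ffun 'I_n -> T}) (i : nat)
  (j k : 'I_n) : k = ((j + i) %% n)%N :> nat -> perm_word x (rotp n ^+ i)%g j = x k.
Proof.
have rotV l : (rotp n)^-1%g l = ordS l.
  by apply: (@perm_inj _ (rotp n)); rewrite permKV permE ordSK.
move=> kE; rewrite ffunE -expVgn; congr (x _); apply: val_inj; rewrite /= kE.
elim: i {kE} => [|i IHi]; first by rewrite expg0 perm1 addn0 modn_small.
by rewrite expgSr permM rotV /= IHi -addn1 modnDml addn1 addnS.
Qed.

(* The sequence is indexed from 0: r k is its (k + 1)-st term. *)
Fixpoint Wtype (r : nat -> nat) (k : nat) : finGroupType :=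
  if k is k'.+1 then wreath_type (Wtype r k') (r k') else 'I_1.

Fixpoint W (r : nat -> nat) (k : nat) : {group Wtype r k} :=
  if k is k'.+1 return {group Wtype r k} then wreath (W r k') (Zrot (r k'))
  else 1%G.

(* A family of irreducible representations containing exactly one member of
   each equivalence class; exists! forbids repetitions in the family. *)
Definition traversal (F : fieldType) (gT : finGroupType) (G : {group gT})
    (I : Type) (rho : I -> representation F G) : Prop :=
  (forall i, mx_irreducible (rho i)) /\
  (forall sigma : representation F G, mx_irreducible sigma ->
     exists! i, mx_rsim sigma (rho i)).

Section FinMatrix.
Variables (R : pzRingType) (T : finType).

Definition fin_mx (A : T -> T -> R) : 'M[R]_#|T| :=
  \matrix_(i, j) A (enum_val i) (enum_val j).

Lemma fin_mx1 (A : T -> T -> R) :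
  (forall s t, A s t = (s == t)%:R) -> fin_mx A = 1%:M.
Proof.
by move=> A1; apply/matrixP=> i j; rewrite !mxE A1 (inj_eq enum_val_inj).
Qed.

Lemma fin_mxM (A B D : T -> T -> R) :
  (forall s t, D s t = \sum_u A s u * B u t) ->
  fin_mx D = fin_mx A *m fin_mx B.
Proof.
move=> DE; apply/matrixP=> i j; rewrite !mxE DE.
have sumT f : \sum_(u : T) f u = \sum_(l < #|T|) f (enum_val l) :> R.
  by rewrite -big_enum_val; apply: eq_bigl.
rewrite sumT.
by apply: eq_bigr => l _; rewrite !mxE.
Qed.

End FinMatrix.

Section Induced.
Variables (F : fieldType) (gT : finGroupType) (H G : {group gT}).

Definition lcoset_type := {A : {set gT} | A \in lcosets H G}.

Definition coset_rep (A : lcoset_type) : gT :=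
  repr (val A).

Lemma coset_repE (A : lcoset_type) : val A = (coset_rep A *: H)%g.
Proof.
case: A => A LA; rewrite /coset_rep /=; case/lcosetsP: (LA) => x _ {LA}->.
exact/esym/lcoset_eqP/(mem_repr _ (lcoset_refl H x)).
Qed.

Lemma mem_coset_rep (A : lcoset_type) y : (y \in val A) = (((coset_rep A)^-1 * y)%g \in H).
Proof. by rewrite coset_repE mem_lcoset. Qed.

Lemma coset_rep_eq (A : lcoset_type) y : y \in val A -> val A = (y *: H)%g.
Proof. by rewrite coset_repE => /lcoset_eqP. Qed.

Lemma coset_repG A : H \subset G -> coset_rep A \in G.
Proof.
move=> sHG; have := lcoset_refl H (coset_rep A); rewrite -coset_repE.
have /lcosetsP[x Gx ->] := valP A; case/lcosetP=> h Hh ->.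
by rewrite groupM // (subsetP sHG).
Qed.

(* In the basis t ⊗ e_p of Ind V, with t in the chosen transversal of the
   left cosets of H in G, the (t, u) block of the matrix of g is that of
   t^-1 g u if t^-1 g u is in H, and 0 otherwise. *)
Definition induced_coef n (rH : mx_representation F H n) (g : gT)
    (s t : lcoset_type * 'I_n) : F :=
  let y := ((coset_rep s.1)^-1 * g * coset_rep t.1)%g in
  if y \in H then rH y s.2 t.2 else 0.

Lemma induced_mx_repr (sHG : H \subset G) n (rH : mx_representation F H n) :
  mx_repr G (fun g => fin_mx (induced_coef rH g)).
Proof.
split=> [|g g' Gg Gg'].
  apply: fin_mx1 => -[A p] [B q]; rewrite /induced_coef /= mulg1.
  rewrite -mem_coset_rep xpair_eqE.
  have -> : (coset_rep B \in val A) = (A == B).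
    apply/idP/eqP=> [/coset_rep_eq AE | ->].
      by apply: val_inj; rewrite AE -coset_repE.
    by rewrite coset_repE lcoset_refl.
  by case: eqP => // ->; rewrite mulVg repr_mx1 mxE.
apply: fin_mxM => -[A p] [B q]; rewrite /induced_coef /=.
have LC : (g' * coset_rep B *: H)%g \in lcosets H G.
  by apply/lcosetsP; exists (g' * coset_rep B)%g; rewrite ?groupM ?coset_repG.
pose C : lcoset_type :=
  exist (fun A : {set gT} => is_true (A \in lcosets H G)) _ LC.
have memC D : ((coset_rep D)^-1 * g' * coset_rep B)%g \in H = (D == C).
  rewrite -mulgA -mem_coset_rep; apply/idP/eqP=> [DB | ->].
    exact/val_inj/coset_rep_eq.
  exact: lcoset_refl.
rewrite -(pair_bigA _ (fun D l =>
   (if ((coset_rep A)^-1 * g * coset_rep D)%g \in H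
    then rH ((coset_rep A)^-1 * g * coset_rep D)%g p l else 0) *
   (if ((coset_rep D)^-1 * g' * coset_rep B)%g \in H
    then rH ((coset_rep D)^-1 * g' * coset_rep B)%g l q else 0))) /=.
rewrite (bigD1 C) //= [X in _ + X]big1 ?addr0 => [|D neDC]; last first.
  by apply: big1 => l _; rewrite memC (negPf neDC) mulr0.
have CB : ((coset_rep C)^-1 * g' * coset_rep B)%g \in H by rewrite memC.
have -> : ((coset_rep A)^-1 * (g * g') * coset_rep B)%g =
  (((coset_rep A)^-1 * g * coset_rep C) *
   ((coset_rep C)^-1 * g' * coset_rep B))%g by rewrite -!mulgA mulKVg.
rewrite CB groupMr //; case: ifP => [HA | _]; last first.
  by rewrite big1 // => l _; rewrite mul0r.
by rewrite repr_mxM // mxE.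
Qed.

Definition induced (sHG : H \subset G) (rH : representation F H) :
    representation F G :=
  Representation (MxRepresentation (induced_mx_repr sHG rH)).

End Induced.

(* The stabilizer Z_(d_x), as a subgroup of the group of rotations Z_n. *)
Definition word_stab n h (x : {ffun 'I_n -> 'I_h}) : {group 'S_n} :=
  'C_(Zrot n)[x | perm_word_action n 'I_h]%G.

Lemma word_stab_sub n h (x : {ffun 'I_n -> 'I_h}) : word_stab x \subset Zrot n.
Proof. exact: subsetIl. Qed.

Lemma word_stabP n h (x : {ffun 'I_n -> 'I_h}) s :
  s \in word_stab x -> perm_word x s = x.
Proof. by case/setIP=> _ /astab1P. Qed.

Lemma word_stabC n h (x : {ffun 'I_n -> 'I_h}) : abelian (word_stab x).
Proof. exact: abelianS (word_stab_sub x) (cycle_abelian _). Qed.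

Section WordRepresentation.
Variables (F : fieldType) (gT : finGroupType) (G : {group gT}) (n h : nat).
Variable rho : 'I_h -> representation F G.
Variable x : {ffun 'I_n -> 'I_h}.

(* The disjoint union of the bases of the rho i, and the matrix of their
   direct sum on it. *)
Definition letter_basis := {i : 'I_h & 'I_(rdegree (rho i))}.

Definition letter_coef (g : gT) (b c : letter_basis) : F :=
  if tag b == tag c then rho (tag b) g (tagged b) (tagged_as b c) else 0.

(* f stands for the vector e_(f 0) ⊗ ... ⊗ e_(f (n - 1)), where e_(f i) is
   a basis vector of rho_(x i). *)
Definition word_basis :=
  {f : {ffun 'I_n -> letter_basis} | [forall i, tag (f i) == x i]}.

(* The coefficient on f of
   (a ; p) (e_(k 0) ⊗ ... ⊗ e_(k (n - 1)))
     = a_0 e_(k (p^-1 0)) ⊗ ... ⊗ a_(n - 1) e_(k (p^-1 (n - 1))). *)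
Definition word_coef (u : wreath_type gT n) (f k : word_basis) : F :=
  \prod_i letter_coef (wbase u i) (val f i) (perm_word (val k) (wtop u) i).

Lemma letter_coef1 b c : letter_coef 1%g b c = (b == c)%:R.
Proof.
case: b c => i p [j q]; rewrite /letter_coef -tag_eqE /tag_eq /=.
by case: eqP => //= eij; rewrite repr_mx1 mxE.
Qed.

Lemma letter_coefM g g' b c : g \in G -> g' \in G ->
  letter_coef (g * g')%g b c = \sum_d letter_coef g b d * letter_coef g' d c.
Proof.
move=> Gg Gg'; case: b c => i p [j q].
pose e l (s : 'I_(rdegree (rho l))) : letter_basis :=
  Tagged (fun i => 'I_(rdegree (rho i))) s.
transitivity (\sum_l \sum_s letter_coef g (e i p) (e l s) *
                            letter_coef g' (e l s) (e j q)); last first.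
  by rewrite sig_big_dep; apply: eq_bigr => -[].
rewrite (bigD1 i) //= [X in _ + X]big1 ?addr0 => [|l neli]; last first.
  by apply: big1 => s _; rewrite /letter_coef /= eq_sym (negPf neli) mul0r.
rewrite /letter_coef /= eqxx; case: eqP => [eij | _]; last first.
  by rewrite big1 // => s _; rewrite mulr0.
subst j; rewrite !tagged_asE repr_mxM // mxE.
by apply: eq_bigr => s _; rewrite /e !tagged_asE.
Qed.

Lemma word_mx_repr :
  mx_repr (wreath G (word_stab x)) (fun u => fin_mx (word_coef u)).
Proof.
split=> [|u v Gu Gv].
  apply: fin_mx1 => f k; rewrite /word_coef perm_word1.
  have [<- | nefk] := eqVneq f k.
    by apply: big1 => i _; rewrite ffunE letter_coef1 eqxx.
  have [i nei]: exists i, val f i != val k i.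
    apply/existsP; apply: contraR nefk => /existsPn efk.
    by apply/eqP/val_inj/ffunP=> i; apply/eqP; have := efk i; rewrite negbK.
  by rewrite (bigD1 i) //= ffunE letter_coef1 (negPf nei) mul0r.
move: Gu Gv; rewrite !mem_wreath.
move=> /andP[/forallP Gu Hu] /andP[/forallP Gv Hv].
have xu i : x ((wtop u)^-1%g i) = x i.
  by rewrite -[in RHS](word_stabP Hu) ffunE.
apply: fin_mxM => f k; rewrite /word_coef /= perm_wordM.
pose c (m : {ffun 'I_n -> letter_basis}) :=
  (\prod_i letter_coef (wbase u i) (val f i) (perm_word m (wtop u) i)) *
  \prod_i letter_coef (wbase v i) (m i) (perm_word (val k) (wtop v) i).
transitivity (\sum_m c m); last first.
  rewrite (bigID (fun m : {ffun _} => [forall i, tag (m i) == x i])) /=.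
  rewrite [X in _ + X]big1 ?addr0 => [|m /forallPn[i nei]].
    by rewrite big_sub.
  rewrite /c (bigD1 (wtop u i)) //= ffunE permK /letter_coef.
  have /forallP/(_ (wtop u i))/eqP xf := valP f.
  by rewrite ifN ?mul0r // [tag _]xf -xu permK eq_sym.
have injw : injective (fun m : {ffun 'I_n -> letter_basis} =>
  perm_word m (wtop u)) := act_inj (perm_word_action n _) (wtop u).
transitivity (\prod_i \sum_d letter_coef (wbase u i) (val f i) d *
    letter_coef (wbase v ((wtop u)^-1%g i)) d
      (perm_word (val k) (wtop v) ((wtop u)^-1%g i))).
  by apply: eq_bigr => i _; rewrite !ffunE letter_coefM.
rewrite bigA_distr_bigA (reindex_inj injw) /=; apply: eq_bigr => m _.
rewrite big_split /=; congr (_ * _).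
rewrite [RHS](reindex_inj (@perm_inj _ (wtop u)^-1%g)) /=.
by apply: eq_bigr => i _; rewrite ffunE.
Qed.

Definition word_repr : representation F (wreath G (word_stab x)) :=
  Representation (MxRepresentation word_mx_repr).

Variable tau : representation F (word_stab x).

(* wtop reverses products, which is harmless as word_stab x is abelian. *)
Lemma top_mx_repr : mx_repr (wreath G (word_stab x)) (fun u => tau (wtop u)).
Proof.
split=> [|u v]; first by rewrite /= repr_mx1.
rewrite !mem_wreath => /andP[_ Hu] /andP[_ Hv] /=.
by rewrite (centsP (word_stabC x) _ Hv _ Hu) repr_mxM.
Qed.

Definition top_repr : representation F (wreath G (word_stab x)) :=
  Representation (MxRepresentation top_mx_repr).

Definition tensor_repr : representation F (wreath G (word_stab x)) :=
  Representation (prod_repr word_repr top_repr).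

End WordRepresentation.

(* Main.v *)
(* A finite family of representations rho_i of G is a traversal exactly when
   no nonzero function c on G is killed by all matrix coefficients, i.e.
   sum_g c(g) rho_i(g) = 0 for all i forces c = 0, and sum_i (deg rho_i)^2 = #|G|:
   the group algebra is then the product of the matrix algebras.  Suppose c on
   W(k+1) is killed by the induced representations.  Letting tau vary isolates
   the trivial rotation in Z_(d_x), and double translation by rotations then
   shows that, on each coset of the base group W(k)^n, c is killed by the
   coefficients of rho_(y_1) ⊗ ... ⊗ rho_(y_n) for every word y of every
   orbit; products of these coefficients span the functions on W(k)^n, so c = 0.
   The sum of squares is counted orbit by orbit. *)
Require Import Defs.
From mathcomp Require Import all_boot all_order all_algebra all_fingroup.
From mathcomp Require Import all_solvable all_character.
From mathcomp Require Import reals complex.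

Set Implicit Arguments.
Unset Strict Implicit.
Unset Printing Implicit Defensive.

Import GroupScope GRing.Theory.
Local Open Scope ring_scope.

(** * Traversals, joint faithfulness and sums of squared degrees *)

Section Traversal.
Variables (F : closedFieldType) (gT : finGroupType) (G : {group gT}).

(** Injectivity of the map from the group algebra of [G] to the product of the matrix algebras. *)
Definition jointly_faithful (I : Type) (rho : I -> representation F G) : Prop :=
  forall c : gT -> F, (forall i, \sum_(g in G) c g *: rho i g = 0) ->
    {in G, forall g, c g = 0}.

Lemma mx_rsim_sum n1 n2 (r1 : mx_representation F G n1)
    (r2 : mx_representation F G n2) (c : gT -> F) :
  mx_rsim r1 r2 ->
  \sum_(g in G) c g *: r2 g = 0 -> \sum_(g in G) c g *: r1 g = 0.
Proof.
case/mx_rsim_def=> B [B' _ r1E] c0.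
transitivity (B *m (\sum_(g in G) c g *: r2 g) *m B'); last first.
  by rewrite c0 mulmx0 mul0mx.
rewrite mulmx_sumr mulmx_suml; apply: eq_bigr => g Gg.
by rewrite r1E // -scalemxAr -scalemxAl.
Qed.

Hypothesis F'G : [pchar F]^'.-group G.

(* sum_g c(g) g kills every simple module, hence the regular module, which
   is semisimple. *)
Lemma traversal_faithful (I : Type) (rho : I -> representation F G) :
  traversal rho -> jointly_faithful rho.
Proof.
case=> _ rho_all c c0 g Gg; apply/eqP.
pose aG := regular_repr F G; pose A := \sum_(x in G) c x *: aG x.
have redG : mx_completely_reducible aG 1%:M by exact: mx_Maschke_pchar.
apply: (mx_reducible_semisimple (mxmodule1 aG) redG) => -[J U W simU defW _].
suffices A0 : A = 0.
  (* The matrices of the regular representation are linearly independent: [gring_proj g] reads off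
     the coefficient of [g]. *)
  have := congr1 (fun B => gring_proj g B) A0; rewrite /A linear_sum linear0.
  rewrite (bigD1 g) //= big1 ?addr0 => [|x /andP[Gx nex]].
    rewrite linearZ /= gring_projE // eqxx => /matrixP/(_ 0 0).
    by rewrite !mxE mulr1 => ->.
  by rewrite linearZ /= gring_projE // eq_sym (negPf nex) scaler0.
(* [A = 0] says that the whole space lies in the kernel of [A], which can be checked on each simple
   summand. *)
apply: row_full_inj (_ : 1%:M *m A = 1%:M *m 0).
  by rewrite row_full_unit unitmx1.
rewrite mulmx0; apply/sub_kermxP; rewrite -defW; apply/sumsmx_subP=> j _.
have [modU _ _] := simU j; have irrU := (submod_mx_irr modU).2 (simU j).
have [i [simi _]] := rho_all (Representation (submod_repr modU)) irrU.
have := mx_rsim_sum simi (c0 i) => /= cU.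
rewrite -(val_submod1 (U j)); apply/sub_kermxP.
rewrite /A mulmx_sumr.
transitivity (val_submod (\sum_(x in G) c x *: submod_repr modU x)).
  rewrite linear_sum; apply: eq_bigr => x Gx.
  by rewrite -scalemxAr [RHS]linearZ /= -val_submodJ // mul1mx.
by rewrite cU linear0.
Qed.

Section Finite.
Variables (I : finType) (rho : I -> representation F G).
Local Notation d i := (rdegree (rho i)).

(** Sending [i] to the class of [rho i] is a bijection onto the irreducible components of the
    regular representation. *)
Lemma traversal_sum_sqr : traversal rho -> (\sum_i d i ^ 2 = #|G|)%N.
Proof.
case=> rho_irr rho_all.
pose sG : irrType F G := DecSocleType (regular_repr F G).
rewrite -(sum_irr_degree_pchar sG F'G (@group_closure_closed_field F gT G)).
have simi i := rsim_irr_comp_pchar sG F'G (rho_irr i).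
rewrite (reindex (fun i => irr_comp sG (rho i))) /=.
  by apply: eq_bigr => i _; rewrite -(mxrank_rsim (simi i)).
have ex (j : sG) : exists i, mx_rsim (irr_repr j) (rho i).
  have [i [simj _]] := rho_all (Representation (irr_repr j)) (socle_irr j).
  by exists i.
have exb (j : sG) : exists i, irr_comp sG (rho i) == j.
  have [i simj] := ex j; exists i.
  by rewrite -(irr_comp_rsim_pchar sG F'G simj) irr_reprK_pchar.
exists (fun j => xchoose (exb j)) => [i | j] _.
  have /eqP eqi := xchooseP (exb (irr_comp sG (rho i))).
  set i' := xchoose _ in eqi *.
  (* Both [i'] and [i] carry a representation similar to [rho i]; the uniqueness in [exists!]
     identifies them. *)
  have [i0 [_ uniq_i]] := rho_all (rho i) (rho_irr i).
  rewrite -(uniq_i i); last exact: mx_rsim_refl.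
  apply/esym/uniq_i/(mx_rsim_trans (simi i)).
  by rewrite -eqi; apply: mx_rsim_sym.
exact/eqP/(xchooseP (exb j)).
Qed.

Definition coef_index := {i : I & ('I_(d i) * 'I_(d i))%type}.

(** The matrix, acting on row vectors, of the map from the group algebra to the product of the
    matrix algebras: [row_free] means injective and [row_full] surjective. *)
Definition coef_mx : 'M[F]_(#|G|, #|{: coef_index}|) :=
  \matrix_(k, l) let b : coef_index := enum_val l in
    rho (tag b) (enum_val k) (tagged b).1 (tagged b).2.

Definition coef_at i (a b : 'I_(d i)) : coef_index :=
  Tagged (fun i => ('I_(d i) * 'I_(d i))%type) (a, b).

Lemma sum_coef_index (f : coef_index -> F) :
  \sum_b f b = \sum_i \sum_a \sum_b f (@coef_at i a b).
Proof.
transitivity (\sum_i \sum_(p : 'I_(d i) * 'I_(d i)) f (coef_at p.1 p.2)).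
  by rewrite sig_big_dep; apply: eq_bigr => -[i [a b]].
by apply: eq_bigr => i _; rewrite pair_bigA.
Qed.

Lemma sum_enum_val (T : finType) (f : T -> F) :
  \sum_(l < #|T|) f (enum_val l) = \sum_b f b.
Proof. by rewrite -big_enum_val; apply: eq_bigl. Qed.

Hypothesis rho_faithful : jointly_faithful rho.

Lemma coef_mx_free : row_free coef_mx.
Proof.
rewrite -kermx_eq0; apply/rowV0P=> v /sub_kermxP v0.
pose c g := v 0 (enum_rank_in (group1 G) g).
have c0 : {in G, forall g, c g = 0}.
  apply: rho_faithful => i; apply/matrixP=> a b.
  have v0ab : (v *m coef_mx) 0 (enum_rank (coef_at a b)) = 0 by rewrite v0 mxE.
  rewrite [RHS]mxE; apply: etrans v0ab; rewrite [RHS]mxE summxE big_enum_val /=.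
  apply: eq_bigr => k _.
  by rewrite !mxE enum_rankK /c enum_valK_in.
apply/rowP=> k; rewrite mxE -[k](enum_valK_in (group1 G)); exact/c0/enum_valP.
Qed.

(** Faithfulness in dual form: the column of [g0] in a right inverse of [coef_mx] expands the
    indicator function of [g0] in matrix coefficients. *)
Lemma delta_coef g0 : g0 \in G -> exists e : forall i, 'M[F]_(d i),
  {in G, forall g, (g == g0)%:R = \sum_i \sum_a \sum_b e i a b * rho i g a b}.
Proof.
move=> Gg0; have [N MN] := row_freeP coef_mx_free.
pose k0 := enum_rank_in (group1 G) g0.
pose e i : 'M[F]_(d i) := \matrix_(a, b) N (enum_rank (coef_at a b)) k0.
exists e => g Gg; pose k := enum_rank_in (group1 G) g.
have := congr1 (fun M : 'M_ _ => M k k0) MN.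
rewrite !mxE (inj_in_eq (can_in_inj (enum_rankK_in (group1 G)))) // => <-.
transitivity (\sum_b rho (tag b) g (tagged b).1 (tagged b).2 *
                     N (enum_rank b) k0).
  rewrite -[RHS]sum_enum_val; apply: eq_bigr => l _.
  by rewrite !mxE enum_rankK_in // enum_valK.
rewrite sum_coef_index; apply: eq_bigr => i _; apply: eq_bigr => a _.
by apply: eq_bigr => b _; rewrite mxE mulrC.
Qed.

Hypothesis sum_sqr : (\sum_i d i ^ 2 = #|G|)%N.

Lemma card_coef_index : #|{: coef_index}| = #|G|.
Proof.
rewrite -sum_sqr card_tagged sumnE big_map big_enum /=.
by apply: eq_bigr => i _; rewrite card_prod card_ord.
Qed.

(** The sum of squares makes [coef_mx] square, so that injectivity gives surjectivity. *)
Lemma coef_onto (B : forall i, 'M[F]_(d i)) :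
  exists c : gT -> F, forall i, \sum_(g in G) c g *: rho i g = B i.
Proof.
have full : row_full coef_mx.
  by rewrite /row_full (eqnP coef_mx_free) card_coef_index.
have [N NM] := row_fullP full.
pose v : 'rV[F]_#|{: coef_index}| :=
  \row_l let b : coef_index := enum_val l in B (tag b) (tagged b).1 (tagged b).2.
exists (fun g => (v *m N) 0 (enum_rank_in (group1 G) g)) => i.
apply/matrixP=> a b.
(* One entry of [v *m N *m coef_mx] in two ways: as an entry of [v], and as a sum over [G]. *)
have := congr1 (fun M : 'rV_ _ => M 0 (enum_rank (coef_at a b)))
  (erefl (v *m N *m coef_mx)).
rewrite -{1}mulmxA NM mulmx1 mxE enum_rankK /= => ->.
rewrite summxE [in RHS]mxE big_enum_val.
by apply: eq_bigr => k _; rewrite !mxE enum_rankK enum_valK_in.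
Qed.

(** Surjectivity onto each matrix algebra is absolute irreducibility, surjectivity onto the product
    separates the factors, and the sum of squares leaves no room for another class. Positive degrees
    exclude zero representations, which neither other condition detects. *)
Lemma faithful_traversal : (forall i, 0 < d i)%N -> traversal rho.
Proof.
move=> d_gt0.
have rho_irr i : mx_irreducible (rho i).
  apply/mx_abs_irrW/mx_abs_irrP; split=> //.
  have ex (A : 'M[F]_(d i)) : exists a : {ffun gT -> F},
      A == \sum_(x in G) a x *: rho i x.
    pose B j : 'M[F]_(d j) :=
      if j =P i is ReflectT ji then
        let e := congr1 (fun l => d l) (esym ji) in castmx (e, e) A else 0.
    have [c /(_ i)] := coef_onto B; rewrite /B; case: eqP => // ii.
    rewrite (eq_irrelevance ii (erefl _)) castmx_id => <-; exists (finfun c).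
    by apply/eqP; apply: eq_bigr => x _; rewrite ffunE.
  exists (fun x A => xchoose (ex A) x) => A.
  exact/eqP/(xchooseP (ex A)).
have rho_inj i j : mx_rsim (rho i) (rho j) -> i = j.
  move=> simij; apply/eqP; apply: contraT => neij.
  (* An element acting as 1 on [rho i] and as 0 on [rho j] contradicts their similarity. *)
  pose B l : 'M[F]_(d l) := if l == i then 1%:M else 0.
  have [c cB] := coef_onto B.
  have := mx_rsim_sum simij; move/(_ c); rewrite !cB /B eqxx eq_sym (negPf neij).
  move/(_ (erefl _))/eqP; rewrite -mxrank_eq0 mxrank1.
  by have := d_gt0 i; case: (d i).
split=> // sigma sigma_irr.
pose sG : irrType F G := DecSocleType (regular_repr F G).
have simi i := rsim_irr_comp_pchar sG F'G (rho_irr i).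
pose f i : sG := irr_comp sG (rho i).
have f_inj : injective f.
  move=> i j eqf; apply: rho_inj; apply: mx_rsim_trans (simi i) _.
  by rewrite -/(f i) eqf; apply: mx_rsim_sym.
have [i fi] : exists i, f i = irr_comp sG sigma.
  suffices /codomP[i ->] : irr_comp sG sigma \in codom f by exists i.
  (* The squared degrees of the rho_i already add up to #|G|. *)
  apply: contraT => nfi.
  have := sum_irr_degree_pchar sG F'G (@group_closure_closed_field F gT G).
  have uniq_f : uniq (codom f) by rewrite map_inj_uniq ?enum_uniq.
  rewrite (bigID (mem (codom f))) /= -big_uniq //=.
  rewrite big_image /= (eq_bigr (fun i => (d i ^ 2)%N)) => [|i _]; last first.
    by rewrite -(mxrank_rsim (simi i)).
  rewrite sum_sqr (bigD1 (irr_comp sG sigma)) //= => /eqP.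
  rewrite -[X in _ == X]addn0 eqn_add2l addn_eq0 expn_eq0 /=.
  by rewrite -[_ == _]negbK -lt0n irr_degree_gt0.
exists i; split=> [|j simj].
  apply: mx_rsim_trans (rsim_irr_comp_pchar sG F'G sigma_irr) _.
  by rewrite -fi; apply: mx_rsim_sym.
apply: rho_inj; apply: mx_rsim_trans simj; apply: mx_rsim_trans (simi i) _.
by rewrite -/(f i) fi; apply/mx_rsim_sym/rsim_irr_comp_pchar.
Qed.

End Finite.
End Traversal.

(** * Matrix entries of tensor products and induced representations *)

Lemma mxtrace_mul_delta (F : fieldType) n (A : 'M[F]_n) i j :
  \tr (A *m delta_mx j i) = A i j.
Proof.
rewrite /mxtrace (bigD1 i) //= big1 ?addr0 => [|l nel].
  rewrite mxE (bigD1 j) //= big1 ?addr0 => [|l nel].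
    by rewrite mxE !eqxx mulr1.
  by rewrite mxE (negPf nel) mulr0.
rewrite mxE big1 // => l' _.
by rewrite mxE (negPf nel) andbF mulr0.
Qed.

(* A product of entries of A and B is the trace of (A ⊗ B)(E ⊗ E') for
   elementary matrices E and E'. *)
Lemma sum_tprod_eq0 (F : fieldType) (T : finType) (P : pred T) n1 n2
    (c : T -> F) (A : T -> 'M[F]_n1) (B : T -> 'M[F]_n2) i j :
  \sum_(t | P t) c t *: tprod (A t) (B t) = 0 ->
  \sum_(t | P t) (c t * A t i j) *: B t = 0.
Proof.
move=> AB0; apply/matrixP=> k l.
have := congr1 (fun M => \tr (M *m tprod (delta_mx j i) (delta_mx l k))) AB0.
rewrite /= mul0mx mxtrace0 mulmx_suml linear_sum /= => e0.
rewrite summxE [RHS]mxE; apply: etrans e0; apply: eq_bigr => t _.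
by rewrite -scalemxAl mxtraceZ -tprodE mxtrace_prod !mxtrace_mul_delta mxE mulrA.
Qed.

Section InducedSum.
Variables (F : fieldType) (gT : finGroupType) (H G : {group gT}).
Hypothesis sHG : H \subset G.
Variables (rH : representation F H) (c : gT -> F).

(* Entry by entry, the vanishing on Ind rH is the one on the double
   translates s H t with s and t^-1 among the coset representatives; all
   other translates follow as rH is multiplicative. *)
Lemma induced_sum_eq0 s t :
    \sum_(g in G) c g *: induced sHG rH g = 0 -> s \in G -> t \in G ->
  \sum_(g in H) c (s * g * t)%g *: rH g = 0.
Proof.
move=> c0 Gs Gt.
have LC x : x \in G -> (x *: H)%g \in lcosets H G.
  by move=> Gx; apply/lcosetsP; exists x.
pose C x (Gx : x \in G) : lcoset_type H G :=
  exist (fun A : {set gT} => is_true (A \in lcosets H G)) _ (LC x Gx).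
have Gt' : t^-1%g \in G by rewrite groupV.
pose s0 := coset_rep (C s Gs); pose t0 := coset_rep (C _ Gt').
have Hs : (s0^-1 * s)%g \in H by rewrite -mem_coset_rep lcoset_refl.
have Ht : (t * t0)%g \in H.
  by rewrite -groupV invMg -mem_coset_rep lcoset_refl.
have Gs0 : s0 \in G by apply: coset_repG.
have Gt0 : t0 \in G by apply: coset_repG.
have c1 : \sum_(g in H) c (s0 * g * t0^-1)%g *: rH g = 0.
  apply/matrixP=> p q.
  have c0pq : (\sum_(g in G) c g *: induced sHG rH g)
      (enum_rank (C s Gs, p)) (enum_rank (C _ Gt', q)) = 0 by rewrite c0 mxE.
  rewrite [RHS]mxE; apply: etrans c0pq; rewrite !summxE.
  rewrite [RHS](eq_bigr (fun g => if (s0^-1 * g * t0)%g \in H then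
     c g * rH (s0^-1 * g * t0)%g p q else 0)) => [|g Gg]; last first.
    by rewrite !mxE !enum_rankK /induced_coef /=; case: ifP; rewrite ?mulr0.
  rewrite -big_mkcondr [RHS](reindex_inj (inj_comp (mulIg t0^-1%g) (mulgI s0))) /=.
  apply: eq_big => [g | g Hg]; last by rewrite mxE !mulgA mulVg mul1g mulgKV.
  rewrite /= !mulgA mulVg mul1g mulgKV andb_idl // => Hg.
  by rewrite !groupM ?groupV // (subsetP sHG).
(* The double translates by [s], [t] and by [s0], [t0^-1] differ by elements of [H], whose matrices
   factor out on both sides. *)
rewrite (reindex_inj (inj_comp (mulIg (t * t0)^-1%g) (mulgI (s0^-1 * s)^-1%g))) /=.
transitivity (rH (s0^-1 * s)^-1%g *m (\sum_(g in H) c (s0 * g * t0^-1)%g *: rH g)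
              *m rH (t * t0)^-1%g); last by rewrite c1 mulmx0 mul0mx.
rewrite mulmx_sumr mulmx_suml; apply: eq_big => [g | g].
  by rewrite groupMr ?groupV // groupMl ?groupV.
rewrite groupMr ?groupV // groupMl ?groupV // => Hg.
rewrite !repr_mxM ?groupM ?groupV // -scalemxAr -scalemxAl; congr (c _ *: _).
by rewrite !invMg invgK !mulgA mulgV mul1g mulgKV.
Qed.
End InducedSum.

Lemma wreath_mulE (gT : finGroupType) n (a b : {ffun 'I_n -> gT}) (s t : 'S_n) :
  (Wreath a s * Wreath b t)%g =
    Wreath [ffun i => (a i * perm_word b s i)%g] (t * s)%g.
Proof. by []. Qed.

(** * Functions on the wreath product killed by the induced representations *)

Section WreathFaithful.
Variables (F : closedFieldType) (gT : finGroupType) (G : {group gT}).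
Variables (n h : nat) (rho : 'I_h -> representation F G).
Hypothesis rho_faithful : jointly_faithful rho.
Local Notation lb := (letter_basis rho).
Local Notation word := {ffun 'I_n -> 'I_h}.

(** [delta_coef] for the direct sum of all the [rho i], with weight 0 off the diagonal blocks: a
    single index set then serves every position of a word. *)
Lemma delta_letter g0 : g0 \in G -> exists e : lb * lb -> F,
  {in G, forall g, (g == g0)%:R = \sum_b e b * letter_coef g b.1 b.2}.
Proof.
move=> Gg0; have [e eE] := delta_coef rho_faithful Gg0.
pose e' (b : lb * lb) :=
  if tag b.1 == tag b.2 then e _ (tagged b.1) (tagged_as b.1 b.2) else 0.
exists e' => g Gg; rewrite eE //.
pose at_ i (a : 'I_(rdegree (rho i))) : lb :=
  Tagged (fun i => 'I_(rdegree (rho i))) a.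
have sum_lb (f : lb -> F) : \sum_b f b = \sum_i \sum_a f (at_ i a).
  by rewrite sig_big_dep; apply: eq_bigr => -[].
rewrite -(pair_bigA _ (fun b c => e' (b, c) * letter_coef g b c)) /=.
rewrite sum_lb; apply: eq_bigr => i _; apply: eq_bigr => a _.
rewrite sum_lb (bigD1 i) //= [X in _ + X]big1 ?addr0 => [|j neji]; last first.
  by apply: big1 => b _; rewrite /e' /= eq_sym (negPf neji) mul0r.
by apply: eq_bigr => b _; rewrite /e' /letter_coef /= eqxx tagged_asE.
Qed.

Variable c : wreath_type gT n -> F.

(** The indicator function of [a0] is the product over positions of those of the [a0 i]; each is
    expanded by [delta_letter] and the product distributed. *)
Lemma wreath_sum_eq0 (s : 'S_n) :
    (forall f k : {ffun 'I_n -> lb}, (forall i, tag (f i) = tag (k i)) ->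
      \sum_(a : {ffun 'I_n -> gT} | [forall i, a i \in G])
        c (Wreath a s) * \prod_i letter_coef (a i) (f i) (k i) = 0) ->
  forall a : {ffun 'I_n -> gT}, (forall i, a i \in G) -> c (Wreath a s) = 0.
Proof.
move=> c0 a0 Ga0.
have ex_e i : exists e : {ffun lb * lb -> F},
    [forall g in G, (g == a0 i)%:R == \sum_b e b * letter_coef g b.1 b.2].
  have [e eE] := delta_letter (Ga0 i); exists (finfun e).
  apply/forall_inP=> g Gg; rewrite eE //; apply/eqP/eq_bigr => b _.
  by rewrite ffunE.
pose e i := xchoose (ex_e i).
have eE i g : g \in G -> (g == a0 i)%:R = \sum_b e i b * letter_coef g b.1 b.2.
  by move=> Gg; apply/eqP; have /forall_inP := xchooseP (ex_e i); apply.
transitivity (\sum_(a : {ffun 'I_n -> gT} | [forall i, a i \in G])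
    c (Wreath a s) * \prod_i (a i == a0 i)%:R).
  rewrite (bigD1 a0) /=; last exact/forallP.
  rewrite [X in c _ * X]big1 ?mulr1 => [|i _]; last by rewrite eqxx.
  rewrite big1 ?addr0 // => a /andP[_ nea].
  have [i nei]: exists i, a i != a0 i.
    apply/existsP; apply: contraR nea => /existsPn ea.
    by apply/eqP/ffunP=> i; apply/eqP; have := ea i; rewrite negbK.
  by rewrite (bigD1 i) //= (negPf nei) mul0r mulr0.
transitivity (\sum_(m : {ffun 'I_n -> lb * lb})
    (\prod_i e i (m i)) * \sum_(a : {ffun 'I_n -> gT} | [forall i, a i \in G])
        c (Wreath a s) * \prod_i letter_coef (a i) (m i).1 (m i).2).
  rewrite (eq_bigr _ (fun m _ => big_distrr _ _ _)) exchange_big /=.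
  apply: eq_bigr => a /forallP Ga.
  rewrite (eq_bigr _ (fun i _ => eE i _ (Ga i))) bigA_distr_bigA big_distrr /=.
  by apply: eq_bigr => m _; rewrite big_split /= mulrCA.
apply: big1 => m _; rewrite [X in _ * X](_ : _ = 0) ?mulr0 //.
(* If the tags differ at some position, the block-diagonal coefficient there is 0. *)
have [/forallP m_tag | /forallPn[i nei]] :=
    boolP [forall i, tag (m i).1 == tag (m i).2].
  rewrite -[RHS](c0 [ffun i => (m i).1] [ffun i => (m i).2]) => [|i].
    by apply: eq_bigr => a _; congr (_ * _); apply: eq_bigr => i _; rewrite !ffunE.
  by rewrite !ffunE; apply/eqP.
apply: big1 => a _; rewrite (bigD1 i) //= /letter_coef (negPf nei) mul0r.
by rewrite mulr0.
Qed.

Section Orbit.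
Variables (x : word) (m : nat) (tau : 'I_m -> representation F (word_stab x)).
Hypothesis tau_faithful : jointly_faithful tau.
Hypothesis c0 : forall i,
  \sum_(g in wreath G (Zrot n)) c g *:
    induced (wreathS G (word_stab_sub x)) (tensor_repr rho (tau i)) g = 0.

(** For fixed [f] and [k], summing over the elements with rotation [q] gives a function [C] of [q]
    killed by every [tau i]. Hence [C 1 = 0], a sum over the base group. *)
Lemma word_sum_eq0 (f k : word_basis rho x) s t :
    s \in wreath G (Zrot n) -> t \in wreath G (Zrot n) ->
  \sum_(a : {ffun 'I_n -> gT} | [forall i, a i \in G])
    c (s * Wreath a 1 * t)%g * \prod_i letter_coef (a i) (val f i) (val k i) = 0.
Proof.
move=> Gs Gt; set S := wreath G (word_stab x).
pose C q := \sum_(u in S | wtop u == q) c (s * u * t)%g * word_coef u f k.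
have C0 : {in word_stab x, forall q, C q = 0}.
  apply: tau_faithful => i.
  have := sum_tprod_eq0 (enum_rank f) (enum_rank k) (induced_sum_eq0 (c0 i) Gs Gt).
  rewrite (partition_big (@wtop _ _) (mem (word_stab x))) /= => [e0|u].
    apply: etrans e0; apply: eq_bigr => q Hq; rewrite scaler_suml.
    by apply: eq_bigr => u /andP[_ /eqP <-]; rewrite mxE !enum_rankK.
  by rewrite mem_wreath => /andP[].
apply: etrans (C0 1%g (group1 _)).
rewrite /C (reindex (fun a => Wreath a 1%g)) /=; last first.
  by exists (@wbase _ _) => [// | [a q] /andP[_ /eqP /= ->]].
apply: eq_big => [a | a _]; first by rewrite mem_wreath group1 eqxx !andbT.
by rewrite /word_coef /= perm_word1.
Qed.

(** Since [(1; p) (a; 1) (1; s * p^-1) = (a^p; s)], translation carries the word [x] to the word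
    [x^p] and the base group to its coset over [s]. *)
Lemma orbit_sum_eq0 p s (f k : {ffun 'I_n -> lb}) :
    p \in Zrot n -> s \in Zrot n ->
    (forall i, tag (f i) = perm_word x p i) ->
    (forall i, tag (k i) = perm_word x p i) ->
  \sum_(a : {ffun 'I_n -> gT} | [forall i, a i \in G])
    c (Wreath a s) * \prod_i letter_coef (a i) (f i) (k i) = 0.
Proof.
move=> Zp Zs f_tag k_tag.
have pull_tag (f' : {ffun 'I_n -> lb}) :
    (forall i, tag (f' i) = perm_word x p i) ->
  [forall i, tag (perm_word f' p^-1%g i) == x i].
  move=> f'_tag; apply/forallP=> i.
  by rewrite ffunE f'_tag ffunE invgK permK.
pose f' : word_basis rho x := Sub (perm_word f p^-1%g) (pull_tag f f_tag).
pose k' : word_basis rho x := Sub (perm_word k p^-1%g) (pull_tag k k_tag).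
have in_base q : q \in Zrot n -> Wreath [ffun=> 1%g] q \in wreath G (Zrot n).
  by move=> Zq; rewrite mem_wreath Zq andbT; apply/forallP=> i; rewrite ffunE.
have := word_sum_eq0 f' k' (in_base p Zp)
          (in_base (s * p^-1)%g (groupM Zs (groupVr Zp))).
rewrite (reindex_inj (act_inj (perm_word_action n gT) p^-1%g)) /= => e0.
apply: etrans e0; apply: eq_big => [a | a Ga].
  apply/forallP/forallP=> Ga i; first by rewrite ffunE.
  by have := Ga (p^-1%g i); rewrite ffunE invgK permKV.
congr (c _ * _).
  rewrite !wreath_mulE mul1g mulgKV; congr Wreath.
  by apply/ffunP=> i; rewrite !ffunE mul1g mulg1 invgK permKV.
rewrite (reindex_inj (@perm_inj _ p)) /=; apply: eq_bigr => i _.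
by rewrite !ffunE invgK.
Qed.
End Orbit.
End WreathFaithful.

(** * Orders, degrees and counting over orbits *)

Lemma card_wreath (gT : finGroupType) n (G : {group gT}) (H : {group 'S_n}) :
  #|wreath G H| = (#|G| ^ n * #|H|)%N.
Proof.
transitivity #|setX [set a : {ffun 'I_n -> gT} | [forall i, a i \in G]] H|.
  rewrite -(card_imset _ (can_inj (@wreath_pairK gT n))); apply: eq_card => -[a s].
  rewrite !inE; apply/imsetP/idP=> [[u Gu [-> ->]] | Gas].
    by rewrite mem_wreath in Gu.
  by exists (Wreath a s); rewrite ?mem_wreath.
rewrite cardsX cardsE; congr (_ * _)%N.
rewrite -[n in RHS]card_ord -card_ffun_on; apply: eq_card => a.
by apply/forallP/ffun_onP.
Qed.

Lemma indexg_wreath (gT : finGroupType) n (G : {group gT}) (K H : {group 'S_n}) :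
  H \subset K -> #|wreath G K : wreath G H| = #|K : H|.
Proof.
move=> sHK; apply/eqP; rewrite -(eqn_pmul2l (cardG_gt0 (wreath G H))).
by rewrite Lagrange ?wreathS // !card_wreath -mulnA Lagrange.
Qed.

Section Degrees.
Variables (F : fieldType) (gT : finGroupType) (G : {group gT}).
Variables (n h : nat) (rho : 'I_h -> representation F G).
Local Notation word := {ffun 'I_n -> 'I_h}.

Lemma card_word_basis (x : word) :
  #|{: word_basis rho x}| = (\prod_i rdegree (rho (x i)))%N.
Proof.
rewrite card_sig.
transitivity #|family (fun i => [pred b : letter_basis rho | tag b == x i])|.
  by apply: eq_card => f; apply/forallP/familyP => fx i; have := fx i.
rewrite card_family foldrE big_map big_enum /=; apply: eq_bigr => i _.
pose in_block := Tagged (fun j => 'I_(rdegree (rho j))) (i := x i).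
rewrite -[RHS]card_ord -(card_image (f := in_block)).
  apply: eq_card => -[j b]; rewrite [LHS]unfold_in /=.
  apply/eqP/imageP=> [ji | [b' _ /(congr1 tag)]//].
  by subst j; exists b.
by move=> b b' /eqP; rewrite eq_Tagged => /eqP.
Qed.

Lemma rdegree_induced (x : word) (tau : representation F (word_stab x)) :
  rdegree (induced (wreathS G (word_stab_sub x)) (tensor_repr rho tau)) =
  (#|Zrot n : word_stab x| * (\prod_i rdegree (rho (x i)) * rdegree tau))%N.
Proof.
rewrite /= card_prod card_ord card_sig.
rewrite -(indexg_wreath G (word_stab_sub x)) -card_lcosets.
by congr (_ * (_ * _))%N; rewrite ?card_word_basis.
Qed.

(** The index of the stabilizer is the size of the orbit, on which [f] is constant. *)
Lemma sum_orbits (J : {set word}) (f : word -> nat) :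
    is_transversal J
      [set orbit (perm_word_action n 'I_h) (Zrot n) x | x : word] [set: word] ->
    (forall x s, f (perm_word x s) = f x) ->
  (\sum_(x in J) #|Zrot n : word_stab x| * f x = \sum_x f x)%N.
Proof.
case/and3P=> partP _ /forall_inP J1 fM.
pose O (x : word) := orbit (perm_word_action n 'I_h) (Zrot n) x.
have P_O x : O x \in [set orbit (perm_word_action n 'I_h) (Zrot n) x | x : word].
  exact: imset_f.
(* [J] meets every orbit, and by [O_inj] below only once, so it indexes the orbits. *)
have imJ : [set O x | x : word] = O @: J.
  apply/setP=> A; apply/imsetP/imsetP=> -[x Jx ->]; last by exists x.
  have /cards1P[y Jy] := J1 _ (P_O x).
  have : y \in J :&: O x by rewrite Jy set11.
  case/setIP=> J_y Oy; exists y => //; exact/esym/orbit_eqP.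
have O_inj : {in J &, injective O}.
  move=> x y Jx Jy Oxy; have /cards1P[z Jz] := J1 _ (P_O x).
  have zE t : t \in J -> O t = O x -> t = z.
    by move=> Jt Ot; apply/set1P; rewrite -Jz inE Jt -/(O x) -Ot orbit_refl.
  by rewrite (zE x) // (zE y).
transitivity (\sum_(x in [set: word]) f x)%N; last first.
  by apply: eq_bigl => x; rewrite inE.
rewrite (set_partition_big _ partP) /= -/O imJ big_imset //=.
apply: eq_bigr => x _; rewrite -card_orbit -sum_nat_const.
by apply: eq_bigr => _ /orbitP[s _ <-]; rewrite fM.
Qed.

Lemma prod_degree_rot (x : word) (s : 'S_n) :
  (\prod_i rdegree (rho (perm_word x s i)) = \prod_i rdegree (rho (x i)))%N.
Proof.
rewrite [RHS](reindex_inj (@perm_inj _ s^-1%g)).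
by apply: eq_bigr => i _; rewrite ffunE.
Qed.
End Degrees.

(** Characteristic 0 makes all group orders invertible, so the criterion applies to [G], to the
    stabilizers and to the wreath product alike. *)
Lemma wreath_traversal (F : closedFieldType) (gT : finGroupType)
    (G : {group gT}) (n h : nat) (rho : 'I_h -> representation F G)
    (J : {set {ffun 'I_n -> 'I_h}}) (m : {ffun 'I_n -> 'I_h} -> nat)
    (tau : forall x : {ffun 'I_n -> 'I_h},
       'I_(m x) -> representation F (word_stab x)) :
    [pchar F] =i pred0 -> traversal rho ->
    is_transversal J
      [set orbit (perm_word_action n 'I_h) (Zrot n) x
         | x : {ffun 'I_n -> 'I_h}] [set: {ffun 'I_n -> 'I_h}] ->
    (forall x, x \in J -> traversal (@tau x)) ->
  traversal
    (fun p : {x : {x : {ffun 'I_n -> 'I_h} | x \in J} & 'I_(m (val x))} =>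
       induced (wreathS G (word_stab_sub (val (tag p))))
         (tensor_repr rho (tau (val (tag p)) (tagged p)))).
Proof.
move=> char0 rho_trav J_trans tau_trav.
have F' (hT : finGroupType) (H : {group hT}) : [pchar F]^'.-group H.
  by apply/pgroupP=> p _ _; rewrite inE /= char0.
have rho_faithful := traversal_faithful (F' _ G) rho_trav.
have irr_gt0 (hT : finGroupType) (H : {group hT}) (s : representation F H) :
  mx_irreducible s -> (0 < rdegree s)%N by case/mx_irrP.
(* There remain joint faithfulness, the sum of squares and positivity of the degrees. *)
apply: faithful_traversal => [|c c0 [a s]||[[x Jx] i]] //.
- rewrite mem_wreath => /andP[/= /forallP Ga Zs].
  apply: (wreath_sum_eq0 rho_faithful _ Ga) => f k f_k.
  pose y := [ffun i => tag (f i)].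
  have [x Jx [p Zp yE]] : exists2 x, x \in J &
      exists2 p, p \in Zrot n & y = perm_word x p.
    case/and3P: J_trans => _ _ /forall_inP J1.
    have /cards1P[x Jx] := J1 _ (imset_f _ (erefl true : y \in predT)).
    have : x \in J :&: orbit (perm_word_action n 'I_h) (Zrot n) y.
      by rewrite Jx set11.
    case/setIP=> J_x; rewrite orbit_sym => /orbitP[p Zp <-].
    by exists x => //; exists p.
  have f_tag i : tag (f i) = perm_word x p i by rewrite -yE ffunE.
  apply: (orbit_sum_eq0 (traversal_faithful (F' _ _) (tau_trav x Jx)) _ Zp Zs) => //.
    by move=> i; apply: (c0 (Tagged (fun x => 'I_(m (val x)))
                            (i : 'I_(m (val (exist _ x Jx)))))).
  by move=> i; rewrite -f_k.
- rewrite card_wreath mulnC.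
  (* With [Z] the rotations and [Z_x] the stabilizer, the terms of a fixed [x] add up to
     [[Z : Z_x]^2 D(x)^2 |Z_x| = |Z| [Z : Z_x] D(x)^2]. By [sum_orbits] the total is [|Z|] times the
     sum of [D(x)^2] over all words, which factors into [n] copies of the sum of squares for [G]. *)
  pose D (x : {ffun 'I_n -> 'I_h}) := (\prod_i rdegree (rho (x i)))%N.
  transitivity (\sum_(x in J) \sum_(i < m x)
      (#|Zrot n : word_stab x| * (D x * rdegree (tau x i))) ^ 2)%N.
    rewrite [RHS]big_sub [RHS]sig_big_dep.
    by apply: eq_bigr => p _; rewrite rdegree_induced.
  transitivity (#|Zrot n| * \sum_(x : {ffun 'I_n -> 'I_h}) D x ^ 2)%N.
    rewrite -(sum_orbits J_trans (f := fun x => (D x ^ 2)%N)); last first.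
      by move=> x s; rewrite /D prod_degree_rot.
    rewrite big_distrr /=; apply: eq_bigr => x Jx.
    rewrite -(Lagrange (word_stab_sub x)).
    rewrite -(traversal_sum_sqr (F' _ _) (tau_trav x Jx)) !big_distrl /=.
    apply: eq_bigr => i _.
    by rewrite !expnMn -mulnn -[RHS]mulnA [RHS]mulnC -!mulnA.
  congr (_ * _)%N; rewrite -(traversal_sum_sqr (F' _ G) rho_trav).
  rewrite -[n in RHS]card_ord -prod_nat_const bigA_distr_bigA /=.
  apply: eq_bigr => x _; rewrite /D -mulnn -big_split.
  by apply: eq_bigr => i _; rewrite -mulnn.
- rewrite rdegree_induced !muln_gt0 indexg_gt0 (irr_gt0 _ _ _ ((tau_trav x Jx).1 i)).
  by rewrite andbT prodn_gt0 // => j; apply: irr_gt0 (rho_trav.1 _).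
Qed.

Theorem theorem1 (R : realType) (r : nat -> nat) (r_gt0 : forall i, (0 < r i)%N)
    (k h : nat)
    (rho : 'I_h -> representation (complex R) (W r k))
    (rho_traversal : traversal rho)
    (J : {set {ffun 'I_(r k) -> 'I_h}})
    (J_representatives :
       is_transversal J
         [set orbit (perm_word_action (r k) 'I_h) (Zrot (r k)) x
            | x : {ffun 'I_(r k) -> 'I_h}]
         [set: {ffun 'I_(r k) -> 'I_h}])
    (m : {ffun 'I_(r k) -> 'I_h} -> nat)
    (tau : forall x : {ffun 'I_(r k) -> 'I_h},
       'I_(m x) -> representation (complex R) (word_stab x))
    (tau_traversal : forall x, x \in J -> traversal (@tau x)) :
  traversal (G := W r k.+1)
    (fun p : {x : {x : {ffun 'I_(r k) -> 'I_h} | x \in J} & 'I_(m (val x))} =>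
       let x := val (tag p) in
       induced (wreathS (W r k) (word_stab_sub x))
         (tensor_repr rho (tau x (tagged p)))).
Proof.
(* [W r k.+1] unfolds to the wreath product of [W r k] by [Zrot (r k)]. *)
apply: wreath_traversal => //; exact: Num.Theory.pchar_num.
Qed.
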